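(* Let $A\in\mathbb F^{n\times n}$ be symmetric positive definite and suppose $$14\,c_A\,\gamma_n\,\kappa_2(A)\bigl(\kappa_2(A)+1\bigr)\le 1 .$$ Execute the floating-point steepest-descent algorithm with recursively updated residual (described in the context) in the standard rounding model with any fixed accumulation order, terminating if the stored residual is zero. For each integer $k\ge 0$ such that the computation through $r_{k+1}$ incurs neither underflow nor overflow, the stored residual satisfies $$\|r_{k+1}\|_{A^{-1}}\le\Bigl(1-\frac1{\kappa_2(A)+1}\Bigr)\|r_k\|_{A^{-1}},\qquad \|r_k\|_2\le\sqrt{\kappa_2(A)}\Bigl(1-\frac1{\kappa_2(A)+1}\Bigr)^k\|r_0\|_2 .$$ Thus the stored residual decreases geometrically for as long as the relative-error model applies. In an unbounded-exponent model it falls below every positive threshold in finitely many steps. (After exact termination, subsequent residuals are set to zero.)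
   Context: $\mathbb F\subset\mathbb R$ is the set of representable floating-point numbers, $u$ is the unit roundoff, and $\operatorname{fl}$ denotes a rounded operation. Standard model: in the absence of underflow/overflow, each scalar operation satisfies $\operatorname{fl}(x\circ y)=(x\circ y)(1+\delta)$, $|\delta|\le u$, $\circ\in\{+,-,\times,/\}$. For a positive integer $s$ with $su<1$, $\gamma_s=su/(1-su)$. Inner products and the rows of a matrix-vector product are accumulated in any fixed order, so that $|\operatorname{fl}(Ar)-Ar|\le\gamma_n|A||r|$ componentwise and $|\operatorname{fl}(\langle x,y\rangle)-\langle x,y\rangle|\le\gamma_n|x|^T|y|$; absolute values of vectors and matrices are componentwise. Here $nu<1$. $\kappa_2(A)=\|A\|_2\|A^{-1}\|_2$, $c_A=\|\,|A|\,\|_2/\|A\|_2$, and $\|x\|_{A^{-1}}=(x^TA^{-1}x)^{1/2}$. Steepest descent with a recursively updated residual, for data $A$, $b$, $x_0$ with floating-point entries: $r_0=\operatorname{fl}(b-Ax_0)$; for $j=0,1,\dots$, stop if $r_j=0$, otherwise $$q_j=\operatorname{fl}(Ar_j),\quad a_j=\operatorname{fl}\!\left(\frac{\operatorname{fl}(\langle r_j,r_j\rangle)}{\operatorname{fl}(\langle q_j,r_j\rangle)}\right),\quad x_{j+1}=\operatorname{fl}(x_j+a_jr_j),\quad r_{j+1}=\operatorname{fl}(r_j-a_jq_j),$$ where in the vector updates each product is rounded before the addition or subtraction, i.e. $(r_{j+1})_i=\operatorname{fl}((r_j)_i-\operatorname{fl}(a_j(q_j)_i))$. *)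

(* Defs.v *)
From HB Require Import structures.
From mathcomp Require Import all_boot all_order all_algebra.
From mathcomp Require Import all_classical all_reals.

Set Implicit Arguments.
Unset Strict Implicit.
Unset Printing Implicit Defensive.

Import Order.TTheory GRing.Theory Num.Theory.
Local Open Scope classical_set_scope.
Local Open Scope ring_scope.

Definition norm2 (R : realType) (n : nat) (x : 'cV[R]_n) : R :=
  Num.sqrt (\sum_(i < n) x i 0 ^+ 2).

(* The supremum is a maximum; the set contains 0 and is bounded above. *)
Definition mxnorm2 (R : realType) (n : nat) (A : 'M[R]_n) : R :=
  sup [set norm2 (A *m x) | x in [set x : 'cV[R]_n | norm2 x <= 1]].

Definition absmx (R : realType) (m n : nat) (A : 'M[R]_(m, n)) : 'M[R]_(m, n) :=
  map_mx (fun a => `|a|) A.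

Definition spd (R : realType) (n : nat) (A : 'M[R]_n) : Prop :=
  A^T = A /\ forall x : 'cV[R]_n, x != 0 -> 0 < (x^T *m A *m x) 0 0.

Definition kappa2 (R : realType) (n : nat) (A : 'M[R]_n) : R :=
  mxnorm2 A * mxnorm2 (invmx A).

Definition cabs (R : realType) (n : nat) (A : 'M[R]_n) : R :=
  mxnorm2 (absmx A) / mxnorm2 A.

Definition normAinv (R : realType) (n : nat) (A : 'M[R]_n) (x : 'cV[R]_n) : R :=
  Num.sqrt ((x^T *m invmx A *m x) 0 0).

(* Meaningful for 0 < s and s%:R * u < 1. *)
Definition gamma (R : realType) (u : R) (s : nat) : R :=
  s%:R * u / (1 - s%:R * u).

Inductive fop := Fadd | Fsub | Fmul | Fdiv.

Definition exact_op (R : realType) (o : fop) (x y : R) : R :=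
  match o with
  | Fadd => x + y
  | Fsub => x - y
  | Fmul => x * y
  | Fdiv => x / y
  end.

Definition op_defined (R : realType) (o : fop) (y : R) : Prop :=
  match o with Fdiv => y != 0 | _ => True end.

(* Nothing is known about the result of an operation that underflows or
   overflows, nor about a division by zero, whose exclusion is not part of the
   absence of underflow and overflow. *)
Record fpmodel (R : realType) := FPModel {
  fpnum : set R;
  roundoff : R;
  fl : fop -> R -> R -> R;
  underflow : fop -> R -> R -> Prop;
  overflow : fop -> R -> R -> Prop;
  roundoff_gt0 : 0 < roundoff;
  fl_standard : forall (o : fop) (x y : R),
    fpnum x -> fpnum y -> op_defined o y ->
    ~ underflow o x y -> ~ overflow o x y ->
    fpnum (fl o x y) /\
    exists delta : R, `|delta| <= roundoff /\
      fl o x y = exact_op o x y * (1 + delta)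
}.

Definition op_ok (R : realType) (M : fpmodel R) (o : fop) (x y : R) : Prop :=
  ~ underflow M o x y /\ ~ overflow M o x y.

Definition unbounded_exponent (R : realType) (M : fpmodel R) : Prop :=
  forall (o : fop) (x y : R),
    fpnum M x -> fpnum M y -> op_defined o y -> op_ok M o x y.

(* An accumulation order for a sum of n terms is a binary tree having each
   index as exactly one leaf; recursive summation in any order of the terms and
   pairwise summation are instances. *)
Inductive sumtree (n : nat) :=
  | Leaf of 'I_n
  | Node of sumtree n & sumtree n.

Fixpoint leaves (n : nat) (t : sumtree n) : seq 'I_n :=
  match t with
  | Leaf i => [:: i]
  | Node l r => leaves l ++ leaves r
  end.

(* The order may differ between the rows of A and between the two inner
   products, but it does not change during the execution. *)
Record schedule (n : nat) := Schedule {
  row_order : 'I_n -> sumtree n;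
  num_order : sumtree n;
  den_order : sumtree n;
  row_orderP : forall i, perm_eq (leaves (row_order i)) (enum 'I_n);
  num_orderP : perm_eq (leaves num_order) (enum 'I_n);
  den_orderP : perm_eq (leaves den_order) (enum 'I_n)
}.

Fixpoint fl_dot (R : realType) (M : fpmodel R) (n : nat) (t : sumtree n)
    (x y : 'I_n -> R) : R :=
  match t with
  | Leaf i => fl M Fmul (x i) (y i)
  | Node l r => fl M Fadd (fl_dot M l x y) (fl_dot M r x y)
  end.

Fixpoint dot_ok (R : realType) (M : fpmodel R) (n : nat) (t : sumtree n)
    (x y : 'I_n -> R) : Prop :=
  match t with
  | Leaf i => op_ok M Fmul (x i) (y i)
  | Node l r => [/\ dot_ok M l x y, dot_ok M r x y &
                    op_ok M Fadd (fl_dot M l x y) (fl_dot M r x y)]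
  end.

Definition fl_mulmxv (R : realType) (M : fpmodel R) (n : nat) (S : schedule n)
    (A : 'M[R]_n) (x : 'cV[R]_n) : 'cV[R]_n :=
  \col_i fl_dot M (row_order S i) (fun j => A i j) (fun j => x j 0).

Definition mulmxv_ok (R : realType) (M : fpmodel R) (n : nat) (S : schedule n)
    (A : 'M[R]_n) (x : 'cV[R]_n) : Prop :=
  forall i, dot_ok M (row_order S i) (fun j => A i j) (fun j => x j 0).

Definition fl_inner (R : realType) (M : fpmodel R) (n : nat) (t : sumtree n)
    (x y : 'cV[R]_n) : R :=
  fl_dot M t (fun j => x j 0) (fun j => y j 0).

Definition inner_ok (R : realType) (M : fpmodel R) (n : nat) (t : sumtree n)
    (x y : 'cV[R]_n) : Prop :=
  dot_ok M t (fun j => x j 0) (fun j => y j 0).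

(* fl(x o a y) for o = +, -, each product being rounded first *)
Definition fl_update (R : realType) (M : fpmodel R) (n : nat) (o : fop)
    (x : 'cV[R]_n) (a : R) (y : 'cV[R]_n) : 'cV[R]_n :=
  \col_i fl M o (x i 0) (fl M Fmul a (y i 0)).

Definition update_ok (R : realType) (M : fpmodel R) (n : nat) (o : fop)
    (x : 'cV[R]_n) (a : R) (y : 'cV[R]_n) : Prop :=
  forall i, op_ok M Fmul a (y i 0) /\ op_ok M o (x i 0) (fl M Fmul a (y i 0)).

Definition sd_init (R : realType) (M : fpmodel R) (n : nat) (S : schedule n)
    (A : 'M[R]_n) (b x0 : 'cV[R]_n) : 'cV[R]_n :=
  \col_i fl M Fsub (b i 0) (fl_mulmxv M S A x0 i 0).

Definition sd_init_ok (R : realType) (M : fpmodel R) (n : nat)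
    (S : schedule n) (A : 'M[R]_n) (b x0 : 'cV[R]_n) : Prop :=
  mulmxv_ok M S A x0 /\
  forall i, op_ok M Fsub (b i 0) (fl_mulmxv M S A x0 i 0).

Definition sd_q (R : realType) (M : fpmodel R) (n : nat) (S : schedule n)
    (A : 'M[R]_n) (r : 'cV[R]_n) : 'cV[R]_n := fl_mulmxv M S A r.

Definition sd_a (R : realType) (M : fpmodel R) (n : nat) (S : schedule n)
    (A : 'M[R]_n) (r : 'cV[R]_n) : R :=
  fl M Fdiv (fl_inner M (num_order S) r r)
            (fl_inner M (den_order S) (sd_q M S A r) r).

(* The state is (x_j, r_j). It is left unchanged once r_j = 0, so that all
   residuals after termination are zero. *)
Definition sd_step (R : realType) (M : fpmodel R) (n : nat) (S : schedule n)
    (A : 'M[R]_n) (s : 'cV[R]_n * 'cV[R]_n) : 'cV[R]_n * 'cV[R]_n :=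
  if s.2 == 0 then s else
  let q := sd_q M S A s.2 in
  let a := sd_a M S A s.2 in
  (fl_update M Fadd s.1 a s.2, fl_update M Fsub s.2 a q).

Definition sd_step_ok (R : realType) (M : fpmodel R) (n : nat)
    (S : schedule n) (A : 'M[R]_n) (s : 'cV[R]_n * 'cV[R]_n) : Prop :=
  s.2 != 0 ->
  let q := sd_q M S A s.2 in
  let a := sd_a M S A s.2 in
  [/\ mulmxv_ok M S A s.2,
      inner_ok M (num_order S) s.2 s.2 /\ inner_ok M (den_order S) q s.2,
      op_ok M Fdiv (fl_inner M (num_order S) s.2 s.2)
                   (fl_inner M (den_order S) q s.2),
      update_ok M Fadd s.1 a s.2
    & update_ok M Fsub s.2 a q].

Definition sd_state (R : realType) (M : fpmodel R) (n : nat) (S : schedule n)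
    (A : 'M[R]_n) (b x0 : 'cV[R]_n) (k : nat) : 'cV[R]_n * 'cV[R]_n :=
  iter k (sd_step M S A) (x0, sd_init M S A b x0).

Definition sd_res (R : realType) (M : fpmodel R) (n : nat) (S : schedule n)
    (A : 'M[R]_n) (b x0 : 'cV[R]_n) (k : nat) : 'cV[R]_n :=
  (sd_state M S A b x0 k).2.

(* No operation executed up to the computation of r_k underflows or overflows. *)
Definition sd_ok_through (R : realType) (M : fpmodel R) (n : nat)
    (S : schedule n) (A : 'M[R]_n) (b x0 : 'cV[R]_n) (k : nat) : Prop :=
  sd_init_ok M S A b x0 /\
  forall j : nat, (j < k)%N -> sd_step_ok M S A (sd_state M S A b x0 j).

(* Main.v *)
(** In the A^-1-norm, the exact steepest descent step with step length
    alpha = |r|^2 / r^T A r contracts by (kappa - 1) / (kappa + 1)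
    (Kantorovich's inequality). With eps = c_A gamma_n and eta = eps kappa, the
    computed q differs from A r by at most eps |A|_2 |r|_2 and the computed
    step length has relative error at most 5 eta; since
    alpha |r|_2 <= |A^-1|_2^(1/2) |r|_{A^-1}, all rounding errors of a step
    together contribute at most 14 eta |r|_{A^-1}, and the hypothesis says that
    14 eta <= 1 / (kappa + 1). The same bounds show that the computed
    denominator is positive, so that no division by zero occurs. *)

Require Import Defs.
From HB Require Import structures.
From mathcomp Require Import all_boot all_order all_algebra.
From mathcomp Require Import all_classical all_reals.
From mathcomp Require Import ring lra.

Set Implicit Arguments.
Unset Strict Implicit.
Unset Printing Implicit Defensive.

Import Order.TTheory GRing.Theory Num.Theory.
Local Open Scope ring_scope.

(** * Quadratic forms of symmetric positive definite matrices *)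

Definition bform (R : realType) (n : nat) (B : 'M[R]_n) (x y : 'cV[R]_n) : R :=
  (x^T *m B *m y) 0 0.

(** For [B = 1%:M] this is [norm2], and for [B = invmx A] it unfolds to [normAinv A], so that one
    Cauchy-Schwarz inequality and one triangle inequality serve both norms. *)
Definition bnorm (R : realType) (n : nat) (B : 'M[R]_n) (x : 'cV[R]_n) : R :=
  Num.sqrt (bform B x x).

Lemma bformDl (R : realType) (n : nat) (B : 'M[R]_n) (x y z : 'cV[R]_n) :
  bform B (x + y) z = bform B x z + bform B y z.
Proof. by rewrite /bform linearD /= !mulmxDl mxE. Qed.

Lemma bformDr (R : realType) (n : nat) (B : 'M[R]_n) (x y z : 'cV[R]_n) :
  bform B x (y + z) = bform B x y + bform B x z.
Proof. by rewrite /bform mulmxDr mxE. Qed.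

Lemma bformZl (R : realType) (n : nat) (B : 'M[R]_n) (a : R) (x y : 'cV[R]_n) :
  bform B (a *: x) y = a * bform B x y.
Proof. by rewrite /bform linearZ /= -!scalemxAl mxE. Qed.

Lemma bformZr (R : realType) (n : nat) (B : 'M[R]_n) (a : R) (x y : 'cV[R]_n) :
  bform B x (a *: y) = a * bform B x y.
Proof. by rewrite /bform -scalemxAr mxE. Qed.

Lemma bform_tr (R : realType) (n : nat) (B : 'M[R]_n) (x y : 'cV[R]_n) :
  bform B x y = bform B^T y x.
Proof.
have -> : bform B x y = (x^T *m B *m y)^T 0 0 by rewrite mxE.
by rewrite !trmx_mul trmxK mulmxA.
Qed.

Lemma bform1E (R : realType) (n : nat) (x y : 'cV[R]_n) :
  bform 1%:M x y = \sum_i x i 0 * y i 0.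
Proof. by rewrite /bform mulmx1 mxE; apply: eq_bigr => i _; rewrite mxE. Qed.

Lemma norm2E (R : realType) (n : nat) (x : 'cV[R]_n) :
  norm2 x = bnorm 1%:M x.
Proof. by rewrite /norm2 /bnorm bform1E. Qed.

Lemma bform1xx (R : realType) (n : nat) (x : 'cV[R]_n) :
  bform 1%:M x x = norm2 x ^+ 2.
Proof.
rewrite sqr_sqrtr; first by rewrite bform1E.
by apply: sumr_ge0 => i _; apply: sqr_ge0.
Qed.

Lemma spd1 (R : realType) (n : nat) : spd (1%:M : 'M[R]_n).
Proof.
split=> [|x x0]; first exact: trmx1.
change (0 < bform 1%:M x x); rewrite bform1E.
have x2 i : 0 <= x i 0 * x i 0 by rewrite -expr2 sqr_ge0.
rewrite lt_def sumr_ge0 // andbT.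
apply: contraNneq x0 => /psumr_eq0P s0; apply/eqP/matrixP => i j.
by rewrite ord1 mxE; apply/eqP; rewrite -sqrf_eq0 expr2 s0.
Qed.

Lemma spd_unitmx (R : realType) (n : nat) (A : 'M[R]_n) :
  spd A -> A \in unitmx.
Proof.
case=> _ Apos; rewrite unitmxE unitfE; apply/negP => /det0P [v v0 vA].
have := Apos v^T; rewrite trmxK vA mul0mx mxE ltxx => H; apply: notF.
by apply: H; rewrite trmx_eq0.
Qed.

Lemma spd_inv (R : realType) (n : nat) (A : 'M[R]_n) :
  spd A -> spd (invmx A).
Proof.
move=> As; have Au := spd_unitmx As; have [At Apos] := As.
split=> [|x x0]; first by rewrite trmx_inv At.
have := Apos (invmx A *m x); rewrite trmx_mul trmx_inv At mulmxKV //.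
rewrite mulmxA; apply.
by apply: contraNneq x0 => x0; rewrite -[x](mulKVmx Au) x0 mulmx0.
Qed.

Lemma bformC (R : realType) (n : nat) (B : 'M[R]_n) (x y : 'cV[R]_n) :
  spd B -> bform B x y = bform B y x.
Proof. by case=> Bt _; rewrite bform_tr Bt. Qed.

Lemma bform0l (R : realType) (n : nat) (B : 'M[R]_n) (x : 'cV[R]_n) :
  bform B 0 x = 0.
Proof. by rewrite /bform trmx0 !mul0mx mxE. Qed.

Lemma bform_gt0 (R : realType) (n : nat) (B : 'M[R]_n) (x : 'cV[R]_n) :
  spd B -> x != 0 -> 0 < bform B x x.
Proof. by case=> _; apply. Qed.

Lemma bform_ge0 (R : realType) (n : nat) (B : 'M[R]_n) (x : 'cV[R]_n) :
  spd B -> 0 <= bform B x x.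
Proof.
move=> Bs; have [->|x0] := eqVneq x 0; first by rewrite bform0l.
exact/ltW/bform_gt0.
Qed.

Lemma cauchy_schwarz (R : realType) (n : nat) (B : 'M[R]_n) (x y : 'cV[R]_n) :
  spd B -> bform B x y ^+ 2 <= bform B x x * bform B y y.
Proof.
move=> Bs; have [->|y0] := eqVneq y 0.
  by rewrite (bformC x) // !bform0l mulr0 expr0n.
have y_gt0 := bform_gt0 Bs y0.
(* The form at this vector is [bform B y y] times the difference of the two sides of the claim. *)
have := bform_ge0 (bform B y y *: x - bform B x y *: y) Bs.
rewrite -scaleNr !bformDl !bformDr !bformZl !bformZr (bformC y x) //.
set a := bform B x x; set b := bform B x y; set c := bform B y y in y_gt0 *.
move=> H; rewrite -(ler_pM2l y_gt0) -subr_ge0; move: H; congr (0 <= _); ring.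
Qed.

Lemma bnorm_ge0 (R : realType) (n : nat) (B : 'M[R]_n) (x : 'cV[R]_n) :
  0 <= bnorm B x.
Proof. exact: sqrtr_ge0. Qed.

Lemma sqr_bnorm (R : realType) (n : nat) (B : 'M[R]_n) (x : 'cV[R]_n) :
  spd B -> bnorm B x ^+ 2 = bform B x x.
Proof. by move=> Bs; rewrite sqr_sqrtr // bform_ge0. Qed.

Lemma bform_le_bnorm (R : realType) (n : nat) (B : 'M[R]_n) (x y : 'cV[R]_n) :
  spd B -> `|bform B x y| <= bnorm B x * bnorm B y.
Proof.
move=> Bs; rewrite -(@ler_pXn2r _ 2) ?nnegrE ?mulr_ge0 ?bnorm_ge0 //.
by rewrite exprMn !sqr_bnorm // real_normK ?num_real // cauchy_schwarz.
Qed.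

Lemma bnormZ (R : realType) (n : nat) (B : 'M[R]_n) (a : R) (x : 'cV[R]_n) :
  bnorm B (a *: x) = `|a| * bnorm B x.
Proof.
by rewrite /bnorm bformZl bformZr mulrA -expr2 sqrtrM ?sqr_ge0 // sqrtr_sqr.
Qed.

Lemma bnormD (R : realType) (n : nat) (B : 'M[R]_n) (x y : 'cV[R]_n) :
  spd B -> bnorm B (x + y) <= bnorm B x + bnorm B y.
Proof.
move=> Bs; rewrite -(@ler_pXn2r _ 2) ?nnegrE ?addr_ge0 ?bnorm_ge0 //.
rewrite sqr_bnorm // bformDl !bformDr (bformC y x) // sqrrD !sqr_bnorm //.
have := bform_le_bnorm x y Bs; rewrite ler_norml => /andP[_]; lra.
Qed.

(** * Euclidean norm and spectral norm *)

Lemma norm2_ge0 (R : realType) (n : nat) (x : 'cV[R]_n) : 0 <= norm2 x.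
Proof. exact: sqrtr_ge0. Qed.

Lemma norm2_gt0 (R : realType) (n : nat) (x : 'cV[R]_n) :
  x != 0 -> 0 < norm2 x.
Proof. by move=> x0; rewrite norm2E sqrtr_gt0 bform_gt0 //; apply: spd1. Qed.

Lemma norm2Z (R : realType) (n : nat) (a : R) (x : 'cV[R]_n) :
  norm2 (a *: x) = `|a| * norm2 x.
Proof. by rewrite !norm2E bnormZ. Qed.

Lemma norm2D (R : realType) (n : nat) (x y : 'cV[R]_n) :
  norm2 (x + y) <= norm2 x + norm2 y.
Proof. by rewrite !norm2E bnormD //; apply: spd1. Qed.

Lemma norm20 (R : realType) (n : nat) : norm2 (0 : 'cV[R]_n) = 0.
Proof. by rewrite norm2E /bnorm bform0l sqrtr0. Qed.

Lemma norm2_le (R : realType) (n : nat) (x y : 'cV[R]_n) :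
  (forall i, `|x i 0| <= y i 0) -> norm2 x <= norm2 y.
Proof.
move=> xy; rewrite ler_wsqrtr // ler_sum // => i _.
by rewrite -real_normK ?num_real // lerXn2r // ?nnegrE // (le_trans _ (xy i)).
Qed.

Lemma norm2_absmx (R : realType) (n : nat) (x : 'cV[R]_n) :
  norm2 (absmx x) = norm2 x.
Proof.
congr Num.sqrt; apply: eq_bigr => i _.
by rewrite mxE real_normK ?num_real.
Qed.

Lemma sum_abs_mul_le (R : realType) (n : nat) (x y : 'cV[R]_n) :
  \sum_i `|x i 0| * `|y i 0| <= norm2 x * norm2 y.
Proof.
have := bform_le_bnorm (absmx x) (absmx y) (spd1 R n).
rewrite -!norm2E !norm2_absmx bform1E; apply: le_trans.
apply: le_trans (ler_norm _); rewrite le_eqVlt; apply/orP; left; apply/eqP.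
by apply: eq_bigr => i _; rewrite !mxE.
Qed.

Lemma entry_le_norm2 (R : realType) (n : nat) (x : 'cV[R]_n) i :
  `|x i 0| <= norm2 x.
Proof.
rewrite -sqrtr_sqr ler_wsqrtr // (bigD1 i) //= lerDl sumr_ge0 // => j _.
exact: sqr_ge0.
Qed.

Lemma abs_mulmx_le (R : realType) (m n : nat) (A : 'M[R]_(m, n)) (x : 'cV[R]_n) i :
  `|(A *m x) i 0| <= (absmx A *m absmx x) i 0.
Proof.
rewrite !mxE (le_trans (ler_norm_sum _ _ _)) // ler_sum // => j _.
by rewrite !mxE normrM.
Qed.

(** On the unit ball every entry of x is at most 1 in absolute value, so the row sums of |A|
    dominate the entries of Ax. *)
Lemma mxnorm2_has_sup (R : realType) (n : nat) (A : 'M[R]_n) :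
  has_sup [set norm2 (A *m x) | x in [set x : 'cV[R]_n | norm2 x <= 1]]%classic.
Proof.
split; first by exists (norm2 (A *m 0)), 0 => //=; rewrite norm20.
exists (norm2 (absmx A *m const_mx 1)) => _ [x /= x1 <-].
apply: norm2_le => i; apply: le_trans (abs_mulmx_le _ _ _) _.
rewrite !mxE ler_sum // => j _; rewrite !mxE ler_wpM2l //.
exact: le_trans (entry_le_norm2 _ _) x1.
Qed.

Lemma norm2_mulmx_le (R : realType) (n : nat) (A : 'M[R]_n) (x : 'cV[R]_n) :
  norm2 (A *m x) <= mxnorm2 A * norm2 x.
Proof.
have [->|x0] := eqVneq x 0; first by rewrite mulmx0 norm20 mulr0.
have x_gt0 := norm2_gt0 x0.
rewrite -ler_pdivrMr // mulrC -[_^-1]ger0_norm ?invr_ge0 ?norm2_ge0 //.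
rewrite -norm2Z scalemxAr; apply: ub_le_sup; first by case: (mxnorm2_has_sup A).
by exists ((norm2 x)^-1 *: x) => //=; rewrite norm2Z ger0_norm ?invr_ge0 ?norm2_ge0 // mulVf ?gt_eqF.
Qed.

Lemma mxnorm2_ge0 (R : realType) (n : nat) (A : 'M[R]_n) : 0 <= mxnorm2 A.
Proof.
rewrite (le_trans (norm2_ge0 (A *m 0))) //; apply: ub_le_sup.
  by case: (mxnorm2_has_sup A).
by exists 0 => //=; rewrite norm20.
Qed.

(** Componentwise |Ax| is at most |A||x|, and |x| has the same norm as x. This is the source of
    [1 <= cabs A]. *)
Lemma mxnorm2_le_absmx (R : realType) (n : nat) (A : 'M[R]_n) :
  mxnorm2 A <= mxnorm2 (absmx A).
Proof.
apply: ge_sup; first by case: (mxnorm2_has_sup A).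
move=> _ [x /= x1 <-].
apply: (le_trans (norm2_le (abs_mulmx_le A x))).
apply: (le_trans (norm2_mulmx_le _ _)); rewrite norm2_absmx.
by rewrite ler_piMr ?mxnorm2_ge0.
Qed.

(** * Spectral bounds, Kantorovich's inequality and the exact step *)

Lemma bform_le_mxnorm2 (R : realType) (n : nat) (A : 'M[R]_n) (x : 'cV[R]_n) :
  bform A x x <= mxnorm2 A * bform 1%:M x x.
Proof.
have -> : bform A x x = bform 1%:M x (A *m x) by rewrite /bform mulmx1 mulmxA.
rewrite (le_trans (ler_norm _)) // (le_trans (bform_le_bnorm _ _ (spd1 R n))) //.
rewrite -!norm2E bform1xx expr2 [leRHS]mulrCA.
by rewrite ler_wpM2l ?norm2_ge0 ?norm2_mulmx_le.
Qed.

(* Cauchy-Schwarz for A in |Ax|^2 = x^T A (Ax), then A <= |A|_2 I at Ax. *)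
Lemma sqr_mulmx_le (R : realType) (n : nat) (A : 'M[R]_n) (x : 'cV[R]_n) :
  spd A -> bform 1%:M (A *m x) (A *m x) <= mxnorm2 A * bform A x x.
Proof.
move=> As; set y := A *m x.
have [y0|y0] := eqVneq (bform 1%:M y y) 0.
  by rewrite y0 mulr_ge0 ?mxnorm2_ge0 ?bform_ge0.
have y_gt0 : 0 < bform 1%:M y y by rewrite lt_def y0 bform_ge0 //; apply: spd1.
have E : bform 1%:M y y = bform A x y.
  by rewrite /bform mulmx1 /y trmx_mul; case: As => ->.
rewrite -(ler_pM2r y_gt0) -expr2 {1}E.
apply: (le_trans (cauchy_schwarz _ _ As)).
by rewrite mulrAC mulrC ler_wpM2r ?bform_ge0 // bform_le_mxnorm2.
Qed.

Lemma bform_inv_mulr (R : realType) (n : nat) (A : 'M[R]_n) (x y : 'cV[R]_n) :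
  spd A -> bform (invmx A) x (A *m y) = bform 1%:M x y.
Proof.
by move=> As; rewrite /bform mulmxA mulmxKV ?spd_unitmx // mulmx1.
Qed.

Lemma bform1_mulr (R : realType) (n : nat) (A : 'M[R]_n) (x y : 'cV[R]_n) :
  bform 1%:M x (A *m y) = bform A x y.
Proof. by rewrite /bform mulmx1 mulmxA. Qed.

Lemma bform1_mull (R : realType) (n : nat) (A : 'M[R]_n) (x y : 'cV[R]_n) :
  spd A -> bform 1%:M (A *m x) y = bform A x y.
Proof. by move=> As; rewrite bformC ?bform1_mulr 1?bformC //; apply: spd1. Qed.

(** This is [sqr_mulmx_le] at the vector A^-1 x. *)
Lemma bform1_le_inv (R : realType) (n : nat) (A : 'M[R]_n) (x : 'cV[R]_n) :
  spd A -> bform 1%:M x x <= mxnorm2 A * bform (invmx A) x x.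
Proof.
move=> As; have := sqr_mulmx_le (invmx A *m x) As.
rewrite -(bform1_mull (A := A)) // !mulKVmx ?spd_unitmx //.
by rewrite bform1_mulr.
Qed.

Lemma bform1_le (R : realType) (n : nat) (A : 'M[R]_n) (x : 'cV[R]_n) :
  spd A -> bform 1%:M x x <= mxnorm2 (invmx A) * bform A x x.
Proof. by move=> As; rewrite -{2}[A]invmxK bform1_le_inv //; apply: spd_inv. Qed.

(** For any nonzero x, |x|^2 <= |A^-1|_2 x^T A x <= kappa |x|^2; such an x exists because n is
    positive. *)
Lemma kappa2_ge1 (R : realType) (n : nat) (A : 'M[R]_n) :
  (0 < n)%N -> spd A -> 1 <= kappa2 A.
Proof.
case: n A => // n A _ As; pose x : 'cV[R]_n.+1 := const_mx 1.
have x0 : x != 0.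
  apply/eqP => /matrixP/(_ 0 0); rewrite !mxE => /eqP.
  by rewrite oner_eq0.
have x_gt0 := bform_gt0 (spd1 R _) x0.
rewrite -(ler_pM2r x_gt0) mul1r (le_trans (bform1_le x As)) //.
rewrite /kappa2 [mxnorm2 A * _]mulrC -mulrA ler_wpM2l ?mxnorm2_ge0 //.
exact: bform_le_mxnorm2.
Qed.

(** Since kappa is at least 1, [mxnorm2 A] is nonzero and the quotient defining [cabs] can be
    cleared. *)
Lemma spd_absmx_norm (R : realType) (n : nat) (A : 'M[R]_n) :
  (0 < n)%N -> spd A -> 1 <= cabs A /\ mxnorm2 (absmx A) = cabs A * mxnorm2 A.
Proof.
move=> n0 As.
have A_gt0 : 0 < mxnorm2 A.
  rewrite lt_def mxnorm2_ge0 andbT; apply/negP => /eqP A0.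
  by have := kappa2_ge1 n0 As; rewrite /kappa2 A0 mul0r ler10.
by rewrite /cabs ler_pdivlMr // mul1r mxnorm2_le_absmx divfK ?gt_eqF.
Qed.

(* With P = mA - 1 and Q = L - A, the claim is PQA^-1 >= 0; since
   P + mQ = mL - 1, it follows from
   (mL - 1) PQA^-1 = P (LA^-1 - 1) P + m Q (m - A^-1) Q,
   the case mL = 1 being trivial. *)
Lemma kantorovich_form (R : realType) (n : nat) (A : 'M[R]_n) (x : 'cV[R]_n) :
  (0 < n)%N -> spd A ->
  mxnorm2 (invmx A) * bform A x x + mxnorm2 A * bform (invmx A) x x
    <= (kappa2 A + 1) * bform 1%:M x x.
Proof.
move=> n0 As; have Ais := spd_inv As; have k1 := kappa2_ge1 n0 As.
move: k1; rewrite /kappa2.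
set L := mxnorm2 A; set m := mxnorm2 (invmx A) => k1.
set s1 := bform A x x; set s0 := bform 1%:M x x; set s' := bform (invmx A) x x.
have m0 : 0 <= m by apply: mxnorm2_ge0.
(* When [L * m = 1], each of the two terms on the left is at most [s0]. *)
have [k_eq1|k_neq1] := eqVneq (L * m) 1.
  have := bform1_le_inv x As; have := bform_le_mxnorm2 (invmx A) x.
  have := bform_le_mxnorm2 A x; rewrite -/L -/m -/s0 -/s1 -/s' k_eq1 => h1 h2 _.
  have L0 : 0 <= L by apply: mxnorm2_ge0.
  have := ler_wpM2l m0 h1; have := ler_wpM2l L0 h2.
  rewrite !mulrA [m * L]mulrC k_eq1 !mul1r; lra.
have k_gt1 : 0 < L * m - 1 by rewrite subr_gt0 lt_def k_neq1.
set s2 := bform 1%:M (A *m x) (A *m x).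
have expand B (c d : R) : spd B ->
    bform B (c *: (A *m x) + d *: x) (c *: (A *m x) + d *: x) =
    c ^+ 2 * bform B (A *m x) (A *m x) + 2 * c * d * bform B x (A *m x)
    + d ^+ 2 * bform B x x.
  move=> Bs; rewrite !bformDl !bformDr !bformZl !bformZr (bformC (A *m x) x) //; ring.
have expand1 c d : bform 1%:M (c *: (A *m x) + d *: x) (c *: (A *m x) + d *: x) =
    c ^+ 2 * s2 + 2 * c * d * s1 + d ^+ 2 * s0.
  by rewrite expand; [rewrite (bform1_mulr A x x) | apply: spd1].
have expandi c d :
    bform (invmx A) (c *: (A *m x) + d *: x) (c *: (A *m x) + d *: x) =
    c ^+ 2 * s1 + 2 * c * d * s0 + d ^+ 2 * s'.
  by rewrite expand // !bform_inv_mulr // bform1_mull.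
(* The vectors inserted here and below are Px and Qx; [hP] and [hQ] are the nonnegativity of the two
   terms of the identity. *)
have := bform1_le_inv (m *: (A *m x) + (- 1) *: x) As.
rewrite expand1 expandi -/L => hP.
have := bform_le_mxnorm2 (invmx A) ((- 1) *: (A *m x) + L *: x).
rewrite expand1 expandi -/m => /(ler_wpM2l m0) hQ.
rewrite -(ler_pM2l k_gt1) -subr_ge0.
have -> : (L * m - 1) * ((L * m + 1) * s0) - (L * m - 1) * (m * s1 + L * s') =
  (L * (m ^+ 2 * s1 + 2 * m * (- 1) * s0 + (- 1) ^+ 2 * s')
   - (m ^+ 2 * s2 + 2 * m * (- 1) * s1 + (- 1) ^+ 2 * s0))
  + (m * (m * ((- 1) ^+ 2 * s2 + 2 * (- 1) * L * s1 + L ^+ 2 * s0))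
     - m * ((- 1) ^+ 2 * s1 + 2 * (- 1) * L * s0 + L ^+ 2 * s')) by ring.
by rewrite addr_ge0 ?subr_ge0.
Qed.

(** The two summands p, q of [kantorovich_form] have product kappa (r^T A r)(r^T A^-1 r) at r = x,
    and 4pq <= (p + q)^2. *)
Lemma kantorovich (R : realType) (n : nat) (A : 'M[R]_n) (x : 'cV[R]_n) :
  (0 < n)%N -> spd A ->
  4 * kappa2 A * (bform A x x * bform (invmx A) x x)
    <= ((kappa2 A + 1) * bform 1%:M x x) ^+ 2.
Proof.
move=> n0 As; have := kantorovich_form x n0 As.
have p0 : 0 <= mxnorm2 (invmx A) * bform A x x.
  by rewrite mulr_ge0 ?mxnorm2_ge0 ?bform_ge0.
have q0 : 0 <= mxnorm2 A * bform (invmx A) x x.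
  by rewrite mulr_ge0 ?mxnorm2_ge0 ?bform_ge0 //; apply: spd_inv.
move=> h; have := lerXn2r 2 _ _ h; rewrite !nnegrE => /(_ (addr_ge0 p0 q0)).
move=> /(_ (le_trans (addr_ge0 p0 q0) h)); apply: le_trans.
rewrite -subr_ge0.
have -> : (mxnorm2 (invmx A) * bform A x x + mxnorm2 A * bform (invmx A) x x) ^+ 2
  - 4 * kappa2 A * (bform A x x * bform (invmx A) x x)
  = (mxnorm2 (invmx A) * bform A x x - mxnorm2 A * bform (invmx A) x x) ^+ 2.
  by rewrite /kappa2; ring.
exact: sqr_ge0.
Qed.

(** With s0, s1, s' the forms of 1, A, A^-1 at r, the squared norm after the step is s' - s0^2 / s1.
    Kantorovich gives s0^2 / s1 >= 4k / (k + 1)^2 s', and 1 - 4k / (k + 1)^2 is the square of the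
    rate. *)
Lemma exact_step (R : realType) (n : nat) (A : 'M[R]_n) (r : 'cV[R]_n) :
  (0 < n)%N -> spd A -> r != 0 ->
  bnorm (invmx A) (r - (bform 1%:M r r / bform A r r) *: (A *m r))
    <= (kappa2 A - 1) / (kappa2 A + 1) * bnorm (invmx A) r.
Proof.
move=> n0 As r0; have Ais := spd_inv As; have k1 := kappa2_ge1 n0 As.
have := kantorovich r n0 As; have s1_gt0 := bform_gt0 As r0.
set k := kappa2 A in k1 *; move=> kant.
have rho0 : 0 <= (k - 1) / (k + 1) by apply: divr_ge0; lra.
rewrite -(@ler_pXn2r _ 2) ?nnegrE ?bnorm_ge0 //; last first.
  by apply: mulr_ge0 => //; apply: bnorm_ge0.
rewrite exprMn !sqr_bnorm // -scaleNr !bformDl !bformDr !bformZl !bformZr.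
rewrite (bformC (A *m r) r) // !bform_inv_mulr // bform1_mull //.
move: s1_gt0 kant.
set s1 := bform A r r; set s0 := bform 1%:M r r; set s' := bform (invmx A) r r.
move=> s1_gt0 kant.
have c_gt0 : 0 < (k + 1) ^+ 2 * s1 by rewrite mulr_gt0 // exprn_gt0 //; lra.
rewrite -(ler_pM2l c_gt0) -subr_ge0.
have k10 : k + 1 != 0 by rewrite gt_eqF //; lra.
have s10 : s1 != 0 by rewrite gt_eqF.
have -> : (k + 1) ^+ 2 * s1 * (((k - 1) / (k + 1)) ^+ 2 * s') -
  (k + 1) ^+ 2 * s1 * (s' + - (s0 / s1) * s0
    + (- (s0 / s1) * s0 + - (s0 / s1) * (- (s0 / s1) * s1)))
  = ((k + 1) * s0) ^+ 2 - 4 * k * (s1 * s') by field; rewrite k10 s10.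
by rewrite subr_ge0.
Qed.

(** * Rounding errors of inner products and vector updates *)

(** As 1 + gamma_s = 1 / (1 - su), the claim is (1 + u)^s (1 - su) <= 1. Induction works because (1
    + u)(1 - (s + 1)u) <= 1 - su. *)
Lemma bernoulli_gamma (R : realType) (u : R) (s : nat) :
  0 < u -> s%:R * u < 1 -> (1 + u) ^+ s - 1 <= gamma u s.
Proof.
move=> u0 su; rewrite lerBlDr /gamma.
have -> : s%:R * u / (1 - s%:R * u) + 1 = (1 - s%:R * u)^-1.
  by field; rewrite gt_eqF // subr_gt0.
rewrite -div1r ler_pdivlMr ?subr_gt0 // {su}.
elim: s => [|s IH]; first by rewrite mul0r subr0 mulr1 expr0.
rewrite exprSr -mulrA; apply: le_trans IH; rewrite ler_wpM2l ?exprn_ge0 //; first lra.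
rewrite -natr1; have : 0 <= s%:R * u * u + u * u by rewrite addr_ge0 ?mulr_ge0 // ltW.
lra.
Qed.

Lemma roundoff_le_gamma (R : realType) (u : R) (s : nat) :
  (0 < s)%N -> 0 < u -> s%:R * u < 1 -> u <= gamma u s.
Proof.
move=> s0 u0 su; rewrite /gamma ler_pdivlMr ?subr_gt0 //.
have s1 : 1 <= s%:R :> R by rewrite ler1n.
have := ler_wpM2r (ltW u0) s1; have : 0 <= u * (s%:R * u).
  by rewrite !mulr_ge0 // ltW.
lra.
Qed.

Lemma fl_error (R : realType) (M : fpmodel R) (o : fop) (x y : R) :
  fpnum M x -> fpnum M y -> op_defined o y -> op_ok M o x y ->
  fpnum M (fl M o x y) /\
  `|fl M o x y - exact_op o x y| <= roundoff M * `|exact_op o x y|.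
Proof.
move=> xf yf od [ou oo]; have [zf [d [du E]]] := fl_standard xf yf od ou oo.
split=> //; rewrite E; set e := exact_op o x y.
have -> : e * (1 + d) - e = d * e by ring.
by rewrite normrM ler_wpM2r.
Qed.

(** Each product passes through one multiplication and one addition per ancestor, hence through at
    most as many roundings as the tree has leaves. Representability is proved along with the bound,
    since the standard model applies only to representable operands. *)
Lemma fl_dot_tree_error (R : realType) (M : fpmodel R) (n : nat) (t : sumtree n)
    (x y : 'I_n -> R) :
  (forall i, fpnum M (x i)) -> (forall i, fpnum M (y i)) -> dot_ok M t x y ->
  fpnum M (fl_dot M t x y) /\
  `|fl_dot M t x y - \sum_(i <- leaves t) x i * y i|
    <= ((1 + roundoff M) ^+ size (leaves t) - 1)
       * \sum_(i <- leaves t) `|x i| * `|y i|.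
Proof.
move=> xf yf; have u0 := roundoff_gt0 M; set u := roundoff M in u0 *.
have u1 : 1 <= 1 + u by lra.
have size_gt0 (t' : sumtree n) : (0 < size (leaves t'))%N.
  by elim: t' => [//|l IHl r IHr]; rewrite /= size_cat addn_gt0 IHl.
elim: t => [i|l IHl r IHr] /=.
  move=> /(fl_error (o := Fmul) (xf i) (yf i) I) [zf e]; split=> //.
  rewrite !big_seq1 -normrM; have -> : (1 + u) ^+ 1 - 1 = u by ring.
  exact: e.
move=> [/IHl [lf le] /IHr [rf re] ok].
have [zf ze] := fl_error (o := Fadd) lf rf I ok; split=> //.
move: ze => /=; rewrite -/u !big_cat /= size_cat.
set p := fl_dot M l x y in le *; set q := fl_dot M r x y in re *.
set sl := \sum_(i <- leaves l) x i * y i in le *.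
set sr := \sum_(i <- leaves r) x i * y i in re *.
set tl := \sum_(i <- leaves l) _ in le *; set tr := \sum_(i <- leaves r) _ in re *.
move=> ze.
have sltl : `|sl| <= tl.
  by rewrite (le_trans (ler_norm_sum _ _ _)) // ler_sum // => i _; rewrite normrM.
have srtr : `|sr| <= tr.
  by rewrite (le_trans (ler_norm_sum _ _ _)) // ler_sum // => i _; rewrite normrM.
(* Both subtrees are nonempty, so even the larger one leaves room for the one extra rounding of the
   addition. *)
pose h := maxn (size (leaves l)) (size (leaves r)).
have hs : (h < size (leaves l) + size (leaves r))%N.
  rewrite /h gtn_max -[X in (X < _)%N]addn0 ltn_add2l size_gt0 /=.
  by rewrite -[X in (X < _)%N]add0n ltn_add2r size_gt0.
have tl0 : 0 <= tl by apply: le_trans sltl.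
have tr0 : 0 <= tr by apply: le_trans srtr.
have le' : `|p - sl| <= ((1 + u) ^+ h - 1) * tl.
  by rewrite (le_trans le) // ler_wpM2r // lerD2r ler_weXn2l // leq_maxl.
have re' : `|q - sr| <= ((1 + u) ^+ h - 1) * tr.
  by rewrite (le_trans re) // ler_wpM2r // lerD2r ler_weXn2l // leq_maxr.
have e2 : `|(p + q) - (sl + sr)| <= ((1 + u) ^+ h - 1) * (tl + tr).
  by rewrite opprD addrACA (le_trans (ler_normD _ _)) // mulrDr lerD.
have e1 : `|p + q| <= (1 + u) ^+ h * (tl + tr).
  rewrite -[p + q](subrK (sl + sr)) (le_trans (ler_normD _ _)) //.
  have := ler_normD sl sr; lra.
(* The new rounding error is at most u (1 + u)^h times [tl + tr], and u (1 + u)^h + (1 + u)^h - 1 =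
   (1 + u)^(h + 1) - 1. *)
have e3 : `|fl M Fadd p q - (sl + sr)| <= ((1 + u) ^+ h.+1 - 1) * (tl + tr).
  have -> : fl M Fadd p q - (sl + sr)
    = (fl M Fadd p q - (p + q)) + ((p + q) - (sl + sr)) by ring.
  rewrite (le_trans (ler_normD _ _)) //; have := ler_wpM2l (ltW u0) e1.
  by rewrite exprS; lra.
rewrite (le_trans e3) // ler_wpM2r ?addr_ge0 // lerD2r ler_weXn2l //.
Qed.

Lemma fl_dot_error (R : realType) (M : fpmodel R) (n : nat) (t : sumtree n)
    (x y : 'I_n -> R) :
  n%:R * roundoff M < 1 -> perm_eq (leaves t) (enum 'I_n) ->
  (forall i, fpnum M (x i)) -> (forall i, fpnum M (y i)) -> dot_ok M t x y ->
  fpnum M (fl_dot M t x y) /\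
  `|fl_dot M t x y - \sum_i x i * y i|
    <= gamma (roundoff M) n * \sum_i `|x i| * `|y i|.
Proof.
move=> nu tP xf yf ok; have [zf] := fl_dot_tree_error xf yf ok.
rewrite (perm_size tP) size_enum_ord !(perm_big _ tP) !big_enum /= => e.
split=> //; apply: (le_trans e); rewrite ler_wpM2r //.
  by apply: sumr_ge0 => i _; rewrite mulr_ge0.
by rewrite bernoulli_gamma ?roundoff_gt0.
Qed.

Lemma dot_ok_unbounded (R : realType) (M : fpmodel R) (n : nat) (t : sumtree n)
    (x y : 'I_n -> R) :
  unbounded_exponent M ->
  (forall i, fpnum M (x i)) -> (forall i, fpnum M (y i)) -> dot_ok M t x y.
Proof.
move=> unb xf yf; elim: t => [i|l IHl r IHr] /=; first exact: unb.
by split=> //; apply: unb => //; apply: (fl_dot_tree_error xf yf _).1.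
Qed.

Lemma fl_mulmxv_error (R : realType) (M : fpmodel R) (n : nat) (S : schedule n)
    (A : 'M[R]_n) (x : 'cV[R]_n) :
  n%:R * roundoff M < 1 ->
  (forall i j, fpnum M (A i j)) -> (forall i, fpnum M (x i 0)) ->
  mulmxv_ok M S A x ->
  (forall i, fpnum M (fl_mulmxv M S A x i 0)) /\
  (forall i, `|(fl_mulmxv M S A x - A *m x) i 0|
               <= gamma (roundoff M) n * (absmx A *m absmx x) i 0).
Proof.
move=> nu Af xf ok.
have E i := fl_dot_error nu (row_orderP S i) (Af i) xf (ok i).
split=> i; rewrite !mxE; first by case: (E i).
case: (E i) => _; suff -> : \sum_j absmx A i j * absmx x j 0
    = \sum_j `|A i j| * `|x j 0| by [].
by apply: eq_bigr => j _; rewrite !mxE.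
Qed.

Lemma fl_inner_error (R : realType) (M : fpmodel R) (n : nat) (t : sumtree n)
    (x y : 'cV[R]_n) :
  n%:R * roundoff M < 1 -> perm_eq (leaves t) (enum 'I_n) ->
  (forall i, fpnum M (x i 0)) -> (forall i, fpnum M (y i 0)) ->
  inner_ok M t x y ->
  fpnum M (fl_inner M t x y) /\
  `|fl_inner M t x y - bform 1%:M x y|
    <= gamma (roundoff M) n * (norm2 x * norm2 y).
Proof.
move=> nu tP xf yf ok; have [zf e] := fl_dot_error nu tP xf yf ok.
split=> //; rewrite bform1E; apply: (le_trans e); rewrite ler_wpM2l ?sum_abs_mul_le //.
by rewrite divr_ge0 ?subr_ge0 ?mulr_ge0 ?ler0n // ltW ?roundoff_gt0.
Qed.

Lemma fl_update_fp (R : realType) (M : fpmodel R) (n : nat) (o : fop)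
    (x y : 'cV[R]_n) (a : R) :
  (forall z : R, op_defined o z) ->
  (forall i, fpnum M (x i 0)) -> fpnum M a -> (forall i, fpnum M (y i 0)) ->
  update_ok M o x a y -> forall i, fpnum M (fl_update M o x a y i 0).
Proof.
move=> od xf af yf ok i; rewrite mxE; have [ok1 ok2] := ok i.
have [pf _] := fl_error (o := Fmul) af (yf i) I ok1.
by have [] := fl_error (xf i) pf (od _) ok2.
Qed.

Lemma update_ok_unbounded (R : realType) (M : fpmodel R) (n : nat) (o : fop)
    (x y : 'cV[R]_n) (a : R) :
  unbounded_exponent M -> (forall z : R, op_defined o z) ->
  (forall i, fpnum M (x i 0)) -> fpnum M a -> (forall i, fpnum M (y i 0)) ->
  update_ok M o x a y.
Proof.
move=> unb od xf af yf i; have ok1 : op_ok M Fmul a (y i 0) by apply: unb.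
split=> //; apply: unb => //.
by have [] := fl_error (o := Fmul) af (yf i) I ok1.
Qed.

(** In each component, with v the exact product and w the entry of x, the product errs by u|v| and
    the subtraction by u(|w| + (1 + u)|v|). *)
Lemma fl_update_sub_error (R : realType) (M : fpmodel R) (n : nat)
    (x y : 'cV[R]_n) (a : R) :
  (forall i, fpnum M (x i 0)) -> fpnum M a -> (forall i, fpnum M (y i 0)) ->
  update_ok M Fsub x a y ->
  norm2 (fl_update M Fsub x a y - (x - a *: y))
    <= roundoff M * (2 + roundoff M) * (`|a| * norm2 y) + roundoff M * norm2 x.
Proof.
move=> xf af yf ok; have u0 := roundoff_gt0 M.
have c0 : 0 <= roundoff M * (2 + roundoff M) by rewrite mulr_ge0 //; lra.
apply: (@le_trans _ _ (norm2 ((roundoff M * (2 + roundoff M)) *: absmx (a *: y)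
                              + roundoff M *: absmx x))); last first.
  rewrite (le_trans (norm2D _ _)) // !norm2Z !norm2_absmx norm2Z.
  by rewrite (ger0_norm c0) (gtr0_norm u0).
apply: norm2_le => i; rewrite !mxE; have [ok1 ok2] := ok i.
have [pf pe] := fl_error (o := Fmul) af (yf i) I ok1.
have [_ ze] := fl_error (o := Fsub) (xf i) pf I ok2.
move: pe ze => /=; set p := fl M Fmul a _; set z := fl M Fsub _ _.
set v := a * y i 0; set w := x i 0; move=> pe ze.
have -> : z - (w - v) = (z - (w - p)) - (p - v) by ring.
have h1 := ler_normB (z - (w - p)) (p - v).
have h2 := ler_normD w (- v - (p - v)).
have h3 := ler_normB (- v) (p - v); rewrite normrN in h3.
have h4 : `|w - p| <= `|w| + `|v| + roundoff M * `|v|.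
  by rewrite (_ : w - p = w + (- v - (p - v))); [lra | ring].
have := ler_wpM2l (ltW u0) h4; lra.
Qed.

(** * Propagation of errors through one step *)

Lemma bnorm_le_sqrt (R : realType) (n : nat) (A : 'M[R]_n) (x : 'cV[R]_n) :
  bnorm A x <= Num.sqrt (mxnorm2 A) * norm2 x.
Proof.
rewrite norm2E -sqrtrM ?mxnorm2_ge0 // ler_wsqrtr //.
exact: bform_le_mxnorm2.
Qed.

Lemma norm2_le_sqrt (R : realType) (n : nat) (A : 'M[R]_n) (x : 'cV[R]_n) :
  spd A -> norm2 x <= Num.sqrt (mxnorm2 A) * bnorm (invmx A) x.
Proof.
move=> As; rewrite norm2E -sqrtrM ?mxnorm2_ge0 // ler_wsqrtr //.
exact: bform1_le_inv.
Qed.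

(** The exact correction, step length times A r, is the orthogonal projection of r onto the line of
    A r in the A^-1 inner product, hence no longer than r. *)
Lemma step_length_mulmx (R : realType) (n : nat) (A : 'M[R]_n) (r : 'cV[R]_n) :
  spd A -> r != 0 ->
  bform 1%:M r r / bform A r r * bnorm (invmx A) (A *m r)
    <= bnorm (invmx A) r.
Proof.
move=> As r0; have s1_gt0 := bform_gt0 As r0; have Ais := spd_inv As.
have s0_ge0 := bform_ge0 r (spd1 R n).
rewrite -ler_pdivlMl ?divr_gt0 ?bform_gt0 //; last exact: spd1.
rewrite ler_pdivlMl ?divr_gt0 ?bform_gt0 //; last exact: spd1.
rewrite -(@ler_pXn2r _ 2) ?nnegrE ?bnorm_ge0 //; last first.
  by rewrite mulr_ge0 ?bnorm_ge0 // divr_ge0 // ltW.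
rewrite exprMn !sqr_bnorm // bform_inv_mulr // bform1_mull //.
have := cauchy_schwarz r (A *m r) Ais.
rewrite !bform_inv_mulr // bform1_mull // => cs.
have -> : (bform 1%:M r r / bform A r r) ^+ 2 * bform A r r
  = bform 1%:M r r ^+ 2 / bform A r r by field; rewrite gt_eqF.
by rewrite ler_pdivrMr.
Qed.

(* |r|^4 <= (r^T A^-1 r)(r^T A r) bounds one factor |r|^2 / r^T A r, and
   |r|^2 <= |A^-1|_2 r^T A r the other. *)
Lemma step_length_norm2 (R : realType) (n : nat) (A : 'M[R]_n) (r : 'cV[R]_n) :
  spd A -> r != 0 ->
  bform 1%:M r r / bform A r r * norm2 r
    <= Num.sqrt (mxnorm2 (invmx A)) * bnorm (invmx A) r.
Proof.
move=> As r0; have s1_gt0 := bform_gt0 As r0; have Ais := spd_inv As.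
apply: le_trans (ler_wpM2l (sqrtr_ge0 _) (step_length_mulmx As r0)).
rewrite mulrCA ler_wpM2l ?divr_ge0 ?bform_ge0 //; first exact: spd1.
rewrite norm2E -sqrtrM ?mxnorm2_ge0 // ler_wsqrtr //.
by rewrite bform_inv_mulr // bform1_mull // bform1_le.
Qed.

(** Errors are compared after multiplication by [den], and eta <= 1/28 absorbs the second-order
    terms: 2 + eta <= 57/28, so [den] is at least (1 - 57/784) s1 = 727/784 s1. *)
Lemma quotient_error (R : realType) (s0 s1 num den a eta : R) :
  0 < s0 -> 0 < s1 -> 0 <= eta -> 28 * eta <= 1 ->
  `|num - s0| <= eta * s0 -> `|den - s1| <= (2 + eta) * eta * s1 ->
  `|a - num / den| <= eta * `|num / den| ->
  `|a - s0 / s1| <= 5 * eta * (s0 / s1).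
Proof.
move=> s0p s1p e0 e1 hn hd ha.
have ee : eta * eta <= eta / 28 by nra.
have es1 : eta * s1 <= s1 / 28 by nra.
have ees1 : (2 + eta) * eta * s1 <= 57 / 28 * (eta * s1) by nra.
have hd' := le_trans hd ees1.
move: (hd'); rewrite ler_norml => /andP[hd1 hd2].
have den_gt0 : 727 / 784 * s1 <= den by lra.
have denp : 0 < den by lra.
have ha' : `|a * den - num| <= eta * `|num|.
  have -> : a * den - num = (a - num / den) * den by field; rewrite gt_eqF.
  rewrite normrM (gtr0_norm denp) -ler_pdivlMr // (le_trans ha) //.
  by rewrite normrM [`|den^-1|]gtr0_norm ?invr_gt0 // mulrA.
have hnum : `|num| <= s0 + eta * s0.
  by have := ler_normD (num - s0) s0; rewrite subrK (gtr0_norm s0p); lra.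
have h1 : `|a * den - s0| <= 57 / 28 * eta * s0.
  have := ler_normD (a * den - num) (num - s0).
  rewrite addrA subrK => h; have := ler_wpM2l e0 hnum; nra.
(* Numerator and division contribute 57/28, and so does the denominator; dividing 57/14 by 727/784
   leaves less than 5. *)
have h2 : `|(a - s0 / s1) * den| <= 57 / 14 * eta * s0.
  have -> : (a - s0 / s1) * den = (a * den - s0) - s0 / s1 * (den - s1).
    by field; rewrite gt_eqF.
  apply: (le_trans (ler_normB _ _)); rewrite normrM.
  have p0 : 0 < s0 / s1 by rewrite divr_gt0.
  rewrite (gtr0_norm p0); have := ler_wpM2l (ltW p0) hd'.
  have -> : s0 / s1 * (57 / 28 * (eta * s1)) = 57 / 28 * eta * s0.
    by field; rewrite gt_eqF.
  lra.
move: h2; rewrite normrM (gtr0_norm denp) => h2.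
rewrite mulrA ler_pdivlMr //.
have h3 : `|a - s0 / s1| * (727 / 784 * s1) <= `|a - s0 / s1| * den.
  by rewrite ler_wpM2l.
have := mulr_ge0 e0 (ltW s0p); lra.
Qed.

(** With u, eps and eta at most 1/28, the three factors besides u k are at most 57/28, 29/28 and
    33/28, whose product is below 5/2. *)
Lemma update_error_coef (R : realType) (u eps eta k : R) :
  0 <= u -> u <= eps -> eps <= eta -> 28 * eta <= 1 -> 0 <= k -> u * k <= eta ->
  u * (2 + u) * (1 + eps) * (1 + 5 * eta) * k <= 5 / 2 * eta.
Proof.
move=> u0 ue ee e28 k0 uk.
have b1 : (2 + u) * (1 + eps) <= 57 / 28 * (29 / 28) by apply: ler_pM; lra.
have p1 : 0 <= (2 + u) * (1 + eps) by apply: mulr_ge0; lra.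
have p2 : 0 <= 1 + 5 * eta by lra.
have b2 : (2 + u) * (1 + eps) * (1 + 5 * eta) <= 5 / 2.
  apply: (@le_trans _ _ (57 / 28 * (29 / 28) * (33 / 28))); last lra.
  by apply: ler_pM => //; lra.
have := ler_pM (mulr_ge0 u0 k0) (mulr_ge0 p1 p2) uk b2; lra.
Qed.

(* The first-order error terms, relative to |r|_{A^-1}, are: the step length
   5 eta, the product A r (eta), and the residual update (3 eta), where
   eta = eps * kappa. *)
Lemma perturbed_step (R : realType) (n : nat) (A : 'M[R]_n)
    (r q r' : 'cV[R]_n) (a u eps : R) :
  (0 < n)%N -> spd A -> r != 0 -> 0 <= u -> u <= eps ->
  14 * eps * kappa2 A * (kappa2 A + 1) <= 1 ->
  norm2 (q - A *m r) <= eps * mxnorm2 A * norm2 r ->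
  `|a - bform 1%:M r r / bform A r r|
    <= 5 * (eps * kappa2 A) * (bform 1%:M r r / bform A r r) ->
  norm2 (r' - (r - a *: q)) <= u * (2 + u) * (`|a| * norm2 q) + u * norm2 r ->
  bnorm (invmx A) r' <= (1 - 1 / (kappa2 A + 1)) * bnorm (invmx A) r.
Proof.
move=> n0 As r0 u0 ue small hq ha hr.
have Ais := spd_inv As; have k1 := kappa2_ge1 n0 As.
have hE := exact_step n0 As r0.
have alpha_gt0 : 0 < bform 1%:M r r / bform A r r.
  by rewrite divr_gt0 ?bform_gt0 //; apply: spd1.
have hA := step_length_mulmx As r0; have hr2 := step_length_norm2 As r0.
have hN x := bnorm_le_sqrt (invmx A) x; have h2 := norm2_le_sqrt r As.
(* The left side is the square root of kappa, which is at most kappa because kappa >= 1. *)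
have GL : Num.sqrt (mxnorm2 (invmx A)) * Num.sqrt (mxnorm2 A) <= kappa2 A.
  rewrite -sqrtrM ?mxnorm2_ge0 // [X in Num.sqrt X]mulrC -/(kappa2 A).
  have k0 : 0 <= kappa2 A by lra.
  rewrite -(@ler_pXn2r _ 2) ?nnegrE ?sqrtr_ge0 // sqr_sqrtr // expr2.
  by rewrite ler_peMr.
have GG : Num.sqrt (mxnorm2 (invmx A)) ^+ 2 * mxnorm2 A = kappa2 A.
  by rewrite sqr_sqrtr ?mxnorm2_ge0 // mulrC.
move: alpha_gt0 ha hE hA hr2 hN h2 GL GG k1 small hq.
set alpha := bform 1%:M r r / bform A r r; set k := kappa2 A; set L := mxnorm2 A.
set G := Num.sqrt (mxnorm2 (invmx A)); set N := bnorm (invmx A).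
set H := Num.sqrt L.
move=> alpha_gt0 ha hE hA hr2 hN h2 GL GG k1 small hq.
have G0 : 0 <= G by apply: sqrtr_ge0.
have L0 : 0 <= L by apply: mxnorm2_ge0.
have Nr0 : 0 <= N r by apply: bnorm_ge0.
have nr0 := norm2_ge0 r; have nq0 := norm2_ge0 q.
have eps0 : 0 <= eps by apply: le_trans ue.
pose eta := eps * k.
have eta0 : 0 <= eta by rewrite mulr_ge0 //; lra.
have eps_eta : eps <= eta by rewrite ler_peMr.
have eta14 : 14 * eta * (k + 1) <= 1 by rewrite /eta; lra.
(* This uses k + 1 >= 2. *)
have eta28 : 28 * eta <= 1 by nra.
have abs_a : `|a| <= (1 + 5 * eta) * alpha.
  have := ler_normD (a - alpha) alpha; rewrite subrK (gtr0_norm alpha_gt0).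
  by rewrite -/eta in ha; lra.
have norm_q : norm2 q <= (1 + eps) * L * norm2 r.
  have := norm2D (q - A *m r) (A *m r); rewrite subrK.
  have := norm2_mulmx_le A r; rewrite -/L; lra.
have c0 : 0 <= 1 + 5 * eta by lra.
have aG : `|a| * norm2 r <= (1 + 5 * eta) * (G * N r).
  apply: (le_trans (ler_wpM2r nr0 abs_a)).
  by rewrite -[leLHS]mulrA ler_wpM2l.
(* Since G^2 L = kappa, errors proportional to |a| |A|_2 |r|_2 cost only one factor kappa in the
   A^-1-norm. *)
have aGL : G * L * (`|a| * norm2 r) <= (1 + 5 * eta) * k * N r.
  apply: (le_trans (ler_wpM2l (mulr_ge0 G0 L0) aG)).
  by rewrite -GG le_eqVlt; apply/orP; left; apply/eqP; ring.
have T1 : N ((alpha - a) *: (A *m r)) <= 5 * eta * N r.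
  rewrite /N bnormZ -/N distrC.
  apply: (le_trans (ler_wpM2r (bnorm_ge0 _ _) ha)).
  rewrite -/eta -[leLHS]mulrA; apply: ler_wpM2l => //; lra.
have T2 : N ((- a) *: (q - A *m r)) <= (1 + 5 * eta) * eta * N r.
  rewrite /N bnormZ -/N normrN.
  have := ler_wpM2l (normr_ge0 a) (le_trans (hN (q - A *m r)) (ler_wpM2l G0 hq)).
  move/le_trans; apply.
  have := ler_wpM2l eps0 aGL; rewrite /eta; lra.
have T3 : N (r' - (r - a *: q))
    <= (u * (2 + u) * (1 + eps) * (1 + 5 * eta) * k + u * k) * N r.
  apply: (le_trans (hN _)); apply: (le_trans (ler_wpM2l G0 hr)).
  rewrite mulrDr [leRHS]mulrDl lerD //.
    have hh : `|a| * norm2 q <= (1 + eps) * (L * (`|a| * norm2 r)).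
      have := ler_wpM2l (normr_ge0 a) norm_q; lra.
    have uu0 : 0 <= u * (2 + u) by rewrite mulr_ge0 // addr_ge0.
    have := ler_wpM2l (mulr_ge0 G0 uu0) hh.
    have uue0 : 0 <= u * (2 + u) * (1 + eps) by rewrite mulr_ge0 // addr_ge0.
    have := ler_wpM2l uue0 aGL; lra.
  have := ler_wpM2l (mulr_ge0 u0 G0) h2; have := ler_wpM2r Nr0 GL.
  move/(ler_wpM2l u0); lra.
have uk : u * k <= eta by rewrite ler_wpM2r //; lra.
have k0 : 0 <= k by lra.
have c3 := update_error_coef u0 ue eps_eta eta28 k0 uk.
have c2 : (1 + 5 * eta) * eta <= 2 * eta by rewrite ler_wpM2r //; lra.
have split_r' : r' = (r - alpha *: (A *m r)) + ((alpha - a) *: (A *m r))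
    + ((- a) *: (q - A *m r)) + (r' - (r - a *: q)).
  rewrite scalerBr !scalerBl scaleNr; apply/matrixP => i j; rewrite !mxE; ring.
have tri x y : N (x + y) <= N x + N y by apply: bnormD.
have -> : 1 - 1 / (k + 1) = (k - 1) / (k + 1) + 1 / (k + 1).
  by field; rewrite gt_eqF //; lra.
(* The perturbations add up to at most (5 + 2 + 5/2 + 1) eta, which is below the available 14
   eta. *)
have final : 14 * eta <= 1 / (k + 1) by rewrite ler_pdivlMr //; lra.
rewrite [X in N X]split_r'.
have t1 := tri (r - alpha *: (A *m r)) ((alpha - a) *: (A *m r)).
have t2 := tri (r - alpha *: (A *m r) + (alpha - a) *: (A *m r))
  ((- a) *: (q - A *m r)).
have t3 := tri (r - alpha *: (A *m r) + (alpha - a) *: (A *m r)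
  + (- a) *: (q - A *m r)) (r' - (r - a *: q)).
have := ler_wpM2r Nr0 final; have := ler_wpM2r Nr0 c3.
have := ler_wpM2r Nr0 c2; have := ler_wpM2r Nr0 uk.
have := mulr_ge0 eta0 Nr0; lra.
Qed.

(** * The computed step *)

(** The conclusion on [sd_a] is conditional on the division because, with unbounded exponent, its
    [op_ok] is available only once the denominator is known to be representable and nonzero. *)
Lemma sd_coefficients_error (R : realType) (M : fpmodel R) (n : nat)
    (S : schedule n) (A : 'M[R]_n) (r : 'cV[R]_n) (eps : R) :
  (0 < n)%N -> n%:R * roundoff M < 1 -> (forall i j, fpnum M (A i j)) ->
  spd A -> eps = cabs A * gamma (roundoff M) n ->
  14 * eps * kappa2 A * (kappa2 A + 1) <= 1 ->
  (forall i, fpnum M (r i 0)) -> r != 0 ->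
  mulmxv_ok M S A r -> inner_ok M (num_order S) r r ->
  inner_ok M (den_order S) (sd_q M S A r) r ->
  let num := fl_inner M (num_order S) r r in
  let den := fl_inner M (den_order S) (sd_q M S A r) r in
  [/\ forall i, fpnum M (sd_q M S A r i 0),
      norm2 (sd_q M S A r - A *m r) <= eps * mxnorm2 A * norm2 r,
      fpnum M num, fpnum M den /\ den != 0 &
      op_ok M Fdiv num den -> fpnum M (sd_a M S A r) /\
      `|sd_a M S A r - bform 1%:M r r / bform A r r|
        <= 5 * (eps * kappa2 A) * (bform 1%:M r r / bform A r r)].
Proof.
move=> n0 nu Af As epsE small rf r0 okq okn okd num den.
have u0 := roundoff_gt0 M; have ug := roundoff_le_gamma n0 u0 nu.
have k1 := kappa2_ge1 n0 As; have [c1 cE] := spd_absmx_norm n0 As.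
have g0 : 0 <= gamma (roundoff M) n by apply: le_trans ug; apply: ltW.
have g_eps : gamma (roundoff M) n <= eps by rewrite epsE ler_peMl.
have eps0 : 0 <= eps by apply: le_trans g_eps.
have [qf qe] := fl_mulmxv_error nu Af rf okq.
rewrite -/(sd_q M S A r) in qf qe.
have hq : norm2 (sd_q M S A r - A *m r) <= eps * mxnorm2 A * norm2 r.
  apply: (@le_trans _ _ (norm2 (gamma (roundoff M) n *: (absmx A *m absmx r)))).
    by apply: norm2_le => i; rewrite [leRHS]mxE.
  rewrite norm2Z (ger0_norm g0).
  have := ler_wpM2l g0 (norm2_mulmx_le (absmx A) (absmx r)).
  by rewrite cE norm2_absmx epsE; move/le_trans; apply; lra.
have [numf nume] := fl_inner_error nu (num_orderP S) rf rf okn.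
have [denf dene] := fl_inner_error nu (den_orderP S) qf rf okd.
rewrite -/num -/den in numf nume denf dene.
have s0_gt0 := bform_gt0 (spd1 R n) r0; have s1_gt0 := bform_gt0 As r0.
have s0E := bform1xx r.
(* This turns errors relative to |A|_2 |r|^2 into errors relative to r^T A r, at the price of a
   factor kappa. *)
have Ls0 : mxnorm2 A * bform 1%:M r r <= kappa2 A * bform A r r.
  by rewrite /kappa2 -mulrA ler_wpM2l ?mxnorm2_ge0 // bform1_le.
pose eta := eps * kappa2 A.
have eta0 : 0 <= eta by rewrite mulr_ge0 //; lra.
have eps_eta : eps <= eta by rewrite ler_peMr.
have eta28 : 28 * eta <= 1.
  have : 14 * eta * (kappa2 A + 1) <= 1 by rewrite /eta; lra.
  by move: eta0 k1; clear; nra.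
have nume' : `|num - bform 1%:M r r| <= eta * bform 1%:M r r.
  apply: (le_trans nume); rewrite -expr2 -s0E.
  exact: ler_wpM2r (ltW s0_gt0) _ _ (le_trans g_eps eps_eta).
have nr0 := norm2_ge0 r.
have qnorm : norm2 (sd_q M S A r) <= (1 + eps) * mxnorm2 A * norm2 r.
  have := norm2D (sd_q M S A r - A *m r) (A *m r); rewrite subrK.
  have := norm2_mulmx_le A r; move: hq; clear; lra.
(* Relative to r^T A r, rounding in the inner product contributes (1 + eps) eta and the error of q
   contributes eta, together at most (2 + eta) eta. *)
have dene1 : `|den - bform 1%:M (sd_q M S A r) r|
    <= eps * ((1 + eps) * (kappa2 A * bform A r r)).
  apply: (le_trans dene); apply: ler_pM => //.
    by rewrite mulr_ge0 ?norm2_ge0.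
  apply: (le_trans (ler_wpM2r nr0 qnorm)).
  have := ler_wpM2l (addr_ge0 ler01 eps0) Ls0; rewrite s0E; clear; lra.
have dene2 : `|bform 1%:M (sd_q M S A r) r - bform A r r|
    <= eps * (kappa2 A * bform A r r).
  have -> : bform 1%:M (sd_q M S A r) r - bform A r r
      = bform 1%:M (sd_q M S A r - A *m r) r.
    by rewrite -scaleN1r bformDl bformZl bform1_mull // mulN1r.
  apply: (le_trans (bform_le_bnorm _ _ (spd1 R n))); rewrite -!norm2E.
  apply: (le_trans (ler_wpM2r nr0 hq)).
  have := ler_wpM2l eps0 Ls0; rewrite s0E; clear; lra.
have dene' : `|den - bform A r r| <= (2 + eta) * eta * bform A r r.
  have := ler_normD (den - bform 1%:M (sd_q M S A r) r)
    (bform 1%:M (sd_q M S A r) r - bform A r r).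
  rewrite addrA subrK => h.
  have p0 : 0 <= eta * bform A r r by rewrite mulr_ge0 // ltW.
  have := ler_wpM2r p0 eps_eta.
  move: h dene1 dene2; rewrite /eta; clear; lra.
have den_gt0 : 0 < den.
  have h : (2 + eta) * eta < 1 by move: eta0 eta28; clear; nra.
  have s1h : (2 + eta) * eta * bform A r r < bform A r r by rewrite gtr_pMl.
  have := le_lt_trans dene' s1h.
  rewrite ltr_norml => /andP[]; clear; lra.
split=> // [|ok]; first by rewrite gt_eqF.
have den_def : op_defined Fdiv den by rewrite /= gt_eqF.
have [af ae] := fl_error numf denf den_def ok.
split=> //; apply: (quotient_error s0_gt0 s1_gt0 eta0 eta28 nume' dene').
rewrite (le_trans ae) // ler_wpM2r //.
exact: le_trans ug (le_trans g_eps eps_eta).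
Qed.

Lemma sd_step_contraction (R : realType) (M : fpmodel R) (n : nat)
    (S : schedule n) (A : 'M[R]_n) (s : 'cV[R]_n * 'cV[R]_n) :
  (0 < n)%N -> n%:R * roundoff M < 1 -> (forall i j, fpnum M (A i j)) ->
  spd A ->
  14 * (cabs A * gamma (roundoff M) n) * kappa2 A * (kappa2 A + 1) <= 1 ->
  (forall i, fpnum M (s.2 i 0)) -> sd_step_ok M S A s ->
  (forall i, fpnum M ((sd_step M S A s).2 i 0)) /\
  normAinv A (sd_step M S A s).2
    <= (1 - 1 / (kappa2 A + 1)) * normAinv A s.2.
Proof.
case: s => x r /= n0 nu Af As small rf ok; rewrite /sd_step /=.
case: (eqVneq r 0) => [r0|r0] /=.
  split=> //; rewrite r0 /normAinv -/(bform _ _ _) bform0l sqrtr0 mulr0 //.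
case: (ok r0) => /= okq [okn okd] okdiv _ okr.
have [qf hq _ _ /(_ okdiv) [af ha]] :=
  sd_coefficients_error n0 nu Af As erefl small rf r0 okq okn okd.
split; first by apply: fl_update_fp.
have u0 := roundoff_gt0 M; have ug := roundoff_le_gamma n0 u0 nu.
have [c1 _] := spd_absmx_norm n0 As.
have u_eps : roundoff M <= cabs A * gamma (roundoff M) n.
  by rewrite (le_trans ug) // ler_peMl // (le_trans _ ug) // ltW.
apply: (perturbed_step n0 As r0 (ltW u0) u_eps small hq ha).
exact: fl_update_sub_error.
Qed.

(** The update of x is among the operations that must be free of exceptions, so representability of
    x has to be propagated as well as that of r. *)
Lemma sd_step_unbounded (R : realType) (M : fpmodel R) (n : nat)
    (S : schedule n) (A : 'M[R]_n) (s : 'cV[R]_n * 'cV[R]_n) :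
  (0 < n)%N -> n%:R * roundoff M < 1 -> (forall i j, fpnum M (A i j)) ->
  spd A ->
  14 * (cabs A * gamma (roundoff M) n) * kappa2 A * (kappa2 A + 1) <= 1 ->
  unbounded_exponent M ->
  (forall i, fpnum M (s.1 i 0)) -> (forall i, fpnum M (s.2 i 0)) ->
  sd_step_ok M S A s /\ (forall i, fpnum M ((sd_step M S A s).1 i 0)).
Proof.
case: s => x r /= n0 nu Af As small unb xf rf; rewrite /sd_step /sd_step_ok /=.
case: (eqVneq r 0) => [r0|r0] //=.
have okq : mulmxv_ok M S A r by move=> i; apply: dot_ok_unbounded.
have [qf _] := fl_mulmxv_error nu Af rf okq.
have okn : inner_ok M (num_order S) r r by apply: dot_ok_unbounded.
have okd : inner_ok M (den_order S) (sd_q M S A r) r.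
  exact: dot_ok_unbounded.
have [_ _ numf [denf den0] /(_ (unb Fdiv _ _ numf denf den0)) [af _]] :=
  sd_coefficients_error n0 nu Af As erefl small rf r0 okq okn okd.
have okx : update_ok M Fadd x (sd_a M S A r) r by apply: update_ok_unbounded.
split; last exact: fl_update_fp.
move=> _; split=> //; [exact: unb | exact: update_ok_unbounded].
Qed.

(** * Iteration and geometric decrease *)

Lemma sd_init_fp (R : realType) (M : fpmodel R) (n : nat) (S : schedule n)
    (A : 'M[R]_n) (b x0 : 'cV[R]_n) :
  n%:R * roundoff M < 1 -> (forall i j, fpnum M (A i j)) ->
  (forall i, fpnum M (b i 0)) -> (forall i, fpnum M (x0 i 0)) ->
  sd_init_ok M S A b x0 -> forall i, fpnum M (sd_init M S A b x0 i 0).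
Proof.
move=> nu Af bf xf [okm ok] i; have [mf _] := fl_mulmxv_error nu Af xf okm.
by rewrite mxE; have [] := fl_error (o := Fsub) (bf i) (mf i) I (ok i).
Qed.

Lemma rate_ge0 (R : realType) (a : R) : 1 <= a -> 0 <= 1 - 1 / (a + 1).
Proof.
move=> a1; have a10 : 0 < a + 1 by lra.
by rewrite subr_ge0 ler_pdivrMr //; lra.
Qed.

Lemma sd_res_geometric (R : realType) (M : fpmodel R) (n : nat)
    (S : schedule n) (A : 'M[R]_n) (b x0 : 'cV[R]_n) (k : nat) :
  (0 < n)%N -> n%:R * roundoff M < 1 -> (forall i j, fpnum M (A i j)) ->
  (forall i, fpnum M (b i 0)) -> (forall i, fpnum M (x0 i 0)) -> spd A ->
  14 * (cabs A * gamma (roundoff M) n) * kappa2 A * (kappa2 A + 1) <= 1 ->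
  sd_ok_through M S A b x0 k ->
  (forall i, fpnum M (sd_res M S A b x0 k i 0)) /\
  normAinv A (sd_res M S A b x0 k)
    <= (1 - 1 / (kappa2 A + 1)) ^+ k * normAinv A (sd_res M S A b x0 0).
Proof.
move=> n0 nu Af bf xf As small; elim: k => [|k IH] [ok0 ok].
  by split; [exact: sd_init_fp | rewrite expr0 mul1r].
have [rf rN] : _ := IH (conj ok0 (fun j jk => ok j (ltnW jk))).
have [r'f r'N] := sd_step_contraction n0 nu Af As small rf (ok k (ltnSn k)).
split=> //; apply: (le_trans r'N); rewrite exprS -mulrA ler_wpM2l //.
exact/rate_ge0/(kappa2_ge1 n0 As).
Qed.

(** Passing to the A^-1-norm and back costs |A|_2^(1/2) and |A^-1|_2^(1/2). It is done once for all
    k steps, so the square root of kappa is not raised to a power. *)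
Lemma norm2_le_normAinv (R : realType) (n : nat) (A : 'M[R]_n)
    (x y : 'cV[R]_n) (c : R) :
  spd A -> 0 <= c -> normAinv A x <= c * normAinv A y ->
  norm2 x <= Num.sqrt (kappa2 A) * c * norm2 y.
Proof.
move=> As c0 xy; rewrite /kappa2 sqrtrM ?mxnorm2_ge0 //.
apply: (le_trans (norm2_le_sqrt x As)); rewrite -!mulrA.
apply: (ler_wpM2l (sqrtr_ge0 _)); apply: (le_trans xy).
by rewrite [leRHS]mulrCA; apply: (ler_wpM2l c0); apply: bnorm_le_sqrt.
Qed.

Lemma sd_ok_through_unbounded (R : realType) (M : fpmodel R) (n : nat)
    (S : schedule n) (A : 'M[R]_n) (b x0 : 'cV[R]_n) (k : nat) :
  (0 < n)%N -> n%:R * roundoff M < 1 -> (forall i j, fpnum M (A i j)) ->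
  (forall i, fpnum M (b i 0)) -> (forall i, fpnum M (x0 i 0)) -> spd A ->
  14 * (cabs A * gamma (roundoff M) n) * kappa2 A * (kappa2 A + 1) <= 1 ->
  unbounded_exponent M -> sd_ok_through M S A b x0 k.
Proof.
move=> n0 nu Af bf xf As small unb.
have okm : mulmxv_ok M S A x0 by move=> i; apply: dot_ok_unbounded.
have [mf _] := fl_mulmxv_error nu Af xf okm.
have ok0 : sd_init_ok M S A b x0 by split=> // i; apply: unb.
(* Representability of both components is the invariant: it makes step j free of exceptions, which
   in turn makes its results representable. *)
have fp j : (forall i, fpnum M ((sd_state M S A b x0 j).1 i 0)) /\
    (forall i, fpnum M ((sd_state M S A b x0 j).2 i 0)).
  elim: j => [|j [xjf rjf]]; first by split=> //; apply: sd_init_fp.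
  have [ok x'f] := sd_step_unbounded S n0 nu Af As small unb xjf rjf.
  by split; [exact: x'f | case: (sd_step_contraction n0 nu Af As small rjf ok)].
split=> // j _; have [xjf rjf] := fp j.
by case: (sd_step_unbounded S n0 nu Af As small unb xjf rjf).
Qed.

(** As 1 - 1 / (a + 1) is the inverse of 1 + 1 / a, Bernoulli's inequality bounds its k-th power by
    1 / (1 + k / a). *)
Lemma exprn_small (R : realType) (a c eps : R) :
  1 <= a -> 0 <= c -> 0 < eps ->
  exists K : nat, forall k : nat, (K <= k)%N ->
    c * (1 - 1 / (a + 1)) ^+ k < eps.
Proof.
move=> a1 c0 eps0; have a_gt0 : 0 < a by lra.
have a10 : 0 < a + 1 by lra.
have bern k : (1 - 1 / (a + 1)) ^+ k * (1 + k%:R / a) <= 1.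
  elim: k => [|k IH]; first by rewrite expr0 mul0r addr0 mulr1.
  rewrite exprSr -mulrA; apply: le_trans IH; apply: ler_wpM2l.
    exact/exprn_ge0/rate_ge0.
  rewrite -natr1 -subr_ge0.
  have -> : 1 + k%:R / a - (1 - 1 / (a + 1)) * (1 + (k%:R + 1) / a)
    = k%:R / (a * (a + 1)) by field; rewrite !gt_eqF.
  by apply: divr_ge0 => //; apply/ltW/mulr_gt0.
(* For k beyond c a / eps one has c < eps k / a, hence c < eps (1 + k / a). *)
have [K hK] : exists K : nat, c * a / eps < K%:R.
  exists (Num.Def.archi_bound (c * a / eps)).
  apply: archi_boundP; apply: divr_ge0; last exact: ltW.
  by apply: mulr_ge0 => //; apply: ltW.
exists K => k Kk; have k_ge : K%:R <= k%:R :> R by rewrite ler_nat.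
move: hK; rewrite ltr_pdivrMr // => hK.
have den : 0 < 1 + k%:R / a by apply: ltr_pwDl => //; apply: divr_ge0 => //; apply: ltW.
rewrite -(ltr_pM2r den) -mulrA.
apply: (le_lt_trans (ler_wpM2l c0 (bern k))); rewrite mulr1.
have h : c * a < k%:R * eps by apply: (lt_le_trans hK); apply: (ler_wpM2r (ltW eps0)).
have : c < k%:R * eps / a by rewrite ltr_pdivlMr.
rewrite mulrDr mulr1; lra.
Qed.

Theorem theorem2 (R : realType) (M : fpmodel R) (n : nat) (S : schedule n)
    (A : 'M[R]_n) (b x0 : 'cV[R]_n)
    (n_gt0 : (0 < n)%N)
    (nu_lt1 : n%:R * roundoff M < 1)
    (A_fp : forall i j, fpnum M (A i j))
    (b_fp : forall i, fpnum M (b i 0))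
    (x0_fp : forall i, fpnum M (x0 i 0))
    (A_spd : spd A)
    (small : 14%:R * cabs A * gamma (roundoff M) n
               * kappa2 A * (kappa2 A + 1) <= 1) :
  (forall k : nat, sd_ok_through M S A b x0 k.+1 ->
     normAinv A (sd_res M S A b x0 k.+1)
       <= (1 - 1 / (kappa2 A + 1)) * normAinv A (sd_res M S A b x0 k)
     /\ norm2 (sd_res M S A b x0 k)
       <= Num.sqrt (kappa2 A) * (1 - 1 / (kappa2 A + 1)) ^+ k
            * norm2 (sd_res M S A b x0 0))
  /\
  (unbounded_exponent M ->
     forall eps : R, 0 < eps ->
       exists K : nat, forall k : nat, (K <= k)%N ->
         norm2 (sd_res M S A b x0 k) < eps).
Proof.
rewrite -(mulrA 14) in small; have k1 := kappa2_ge1 n_gt0 A_spd.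
have rho0 := rate_ge0 k1.
have bound k : sd_ok_through M S A b x0 k ->
    (forall i, fpnum M (sd_res M S A b x0 k i 0)) /\
    norm2 (sd_res M S A b x0 k)
      <= Num.sqrt (kappa2 A) * (1 - 1 / (kappa2 A + 1)) ^+ k
           * norm2 (sd_res M S A b x0 0).
  move=> ok; have [rf rN] := sd_res_geometric n_gt0 nu_lt1 A_fp b_fp x0_fp A_spd small ok.
  by split=> //; apply: norm2_le_normAinv rN => //; apply: exprn_ge0.
split=> [k [ok0 ok] | unb eps eps0].
  (* The operations through [r_k] give the bound and representability of [r_k]; the remaining step
     gives the contraction. *)
  have [rf r2] := bound k (conj ok0 (fun j jk => ok j (ltnW jk))).
  split=> //.
  by case: (sd_step_contraction n_gt0 nu_lt1 A_fp A_spd small rf (ok k (ltnSn k))).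
have c0 : 0 <= Num.sqrt (kappa2 A) * norm2 (sd_res M S A b x0 0).
  by rewrite mulr_ge0 ?sqrtr_ge0 ?norm2_ge0.
have [K hK] := exprn_small k1 c0 eps0.
exists K => k Kk; apply: le_lt_trans (hK k Kk); rewrite mulrAC.
by apply: (bound k _).2; apply: sd_ok_through_unbounded.
Qed.
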